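(* Arithmetic $(\mathbb{Z},+,\times)$ is interpretable in every reduced indecomposable polynomial ring $B[\mathcal{X}]$ ($B$ a reduced indecomposable commutative unital ring, $\mathcal{X}$ a nonempty set of indeterminates). More precisely, the class of such rings is the union of finitely many subclasses (namely: rings $B[\mathcal{X}]$ with $B$ not a field; polynomial rings over a reduced indecomposable ring of characteristic zero; univariate polynomial rings over a field of positive characteristic), on each of which arithmetic is uniformly interpretable.
   Context: A commutative unital ring is reduced if $0$ is its only nilpotent element and indecomposable if its only idempotents are $0$ and $1$; $B[\mathcal{X}]$ is reduced (resp. indecomposable) iff $B$ is. An interpretation is uniform over a class of rings if the same first-order formulas in the language of rings (domain formula, formula for equality, and formulas for the graphs of $+$ and $\times$ of the interpreted structure) work for every ring in the class. *)

(* Defs.v *)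
From mathcomp Require Import all_boot all_algebra.
From mathcomp.multinomials Require Export monalg.

Set Implicit Arguments.
Unset Strict Implicit.
Unset Printing Implicit Defensive.

Import GRing.Theory.
Local Open Scope ring_scope.

Inductive rterm : Type :=
  | RVar of nat
  | RZero
  | ROne
  | RAdd of rterm & rterm
  | ROpp of rterm
  | RMul of rterm & rterm.

Inductive rformula : Type :=
  | FEq of rterm & rterm
  | FFalse
  | FNot of rformula
  | FAnd of rformula & rformula
  | FOr of rformula & rformula
  | FImp of rformula & rformula
  | FExists of nat & rformula
  | FForall of nat & rformula.

Section Semantics.
Variable R : comNzRingType.

Fixpoint reval (e : nat -> R) (t : rterm) : R :=
  match t with
  | RVar i => e i
  | RZero => 0
  | ROne => 1
  | RAdd s u => reval e s + reval e u
  | ROpp s => - reval e s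
  | RMul s u => reval e s * reval e u
  end.

Definition upd (e : nat -> R) (i : nat) (x : R) : nat -> R :=
  fun j => if j == i then x else e j.

Fixpoint rholds (e : nat -> R) (f : rformula) : Prop :=
  match f with
  | FEq s u => reval e s = reval e u
  | FFalse => False
  | FNot g => ~ rholds e g
  | FAnd g h => rholds e g /\ rholds e h
  | FOr g h => rholds e g \/ rholds e h
  | FImp g h => rholds e g -> rholds e h
  | FExists i g => exists x : R, rholds (upd e i x) g
  | FForall i g => forall x : R, rholds (upd e i x) g
  end.

Definition senv (s : seq R) : nat -> R := fun i => nth 0 s i.

End Semantics.

Record interp_data : Type := InterpData {
  idim : nat;          (* dimension k of the interpretation *)
  idom : rformula;     (* domain formula, free vars 0..k-1 *)
  ieq  : rformula;     (* equality, free vars 0..2k-1 *)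
  iadd : rformula;     (* graph of +, free vars 0..3k-1 *)
  imul : rformula      (* graph of x, free vars 0..3k-1 *)
}.

Definition interprets_Z (R : comNzRingType) (I : interp_data) : Prop :=
  let k := idim I in
  let D (x : k.-tuple R) := rholds (senv x) (idom I) in
  exists f : k.-tuple R -> int,
    (forall n : int, exists x : k.-tuple R, D x /\ f x = n) /\
    (forall x y : k.-tuple R, D x -> D y ->
       (rholds (senv (x ++ y)) (ieq I) <-> f x = f y)) /\
    (forall x y z : k.-tuple R, D x -> D y -> D z ->
       (rholds (senv (x ++ y ++ z)) (iadd I) <-> f x + f y = f z)) /\
    (forall x y z : k.-tuple R, D x -> D y -> D z ->
       (rholds (senv (x ++ y ++ z)) (imul I) <-> f x * f y = f z)).

Definition arith_interpretable (R : comNzRingType) : Prop :=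
  exists I : interp_data, interprets_Z R I.

Definition uniformly_interpretable (C : comNzRingType -> Prop) : Prop :=
  exists I : interp_data, forall R : comNzRingType, C R -> interprets_Z R I.

Definition reduced (B : comNzRingType) : Prop :=
  forall (x : B) (n : nat), x ^+ n = 0 -> x = 0.

Definition indecomposable (B : comNzRingType) : Prop :=
  forall e : B, e * e = e -> e = 0 \/ e = 1.

Definition is_field (B : comNzRingType) : Prop :=
  forall x : B, x != 0 -> exists y : B, x * y = 1.

Definition char_zero (B : comNzRingType) : Prop :=
  forall n : nat, n%:R = 0 :> B -> n = 0%N.

Definition ring_iso (A R : comNzRingType) : Prop :=
  exists f : {rmorphism A -> R}, bijective f.

Definition polyring (B : comNzRingType) (X : choiceType) : comNzRingType :=
  {malg B[{cmonom X}]}.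

Definition red_indec_polyring (R : comNzRingType) : Prop :=
  exists (B : comNzRingType) (X : choiceType),
    reduced B /\ indecomposable B /\ inhabited X /\ ring_iso (polyring B X) R.

Definition class_nonfield (R : comNzRingType) : Prop :=
  exists (B : comNzRingType) (X : choiceType),
    reduced B /\ indecomposable B /\ ~ is_field B /\ inhabited X /\
    ring_iso (polyring B X) R.

Definition class_char0 (R : comNzRingType) : Prop :=
  exists (B : comNzRingType) (X : choiceType),
    reduced B /\ indecomposable B /\ char_zero B /\ inhabited X /\
    ring_iso (polyring B X) R.

Definition class_fieldpos (R : comNzRingType) : Prop :=
  exists F : fieldType,
    (exists n : nat, (0 < n)%N /\ n%:R = 0 :> F) /\
    ring_iso [the comNzRingType of {poly F}] R.

(* Main.v *)
Require Import Defs.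
From HB Require Import structures.
From mathcomp Require Import all_boot all_algebra.
From mathcomp Require Import finmap.
From mathcomp Require Import zify ring.
From Stdlib Require Import Classical ClassicalEpsilon FunctionalExtensionality.

(** Every ring in question is a polynomial ring [A[x]] over a reduced
    indecomposable ring [A], and one interpretation works for all of them.
    Call [v] a power of [t] when every divisor of [v] is a unit or a multiple of
    [t], and [t - 1] divides [v - 1]. For [t = x] this defines exactly
    [{x^n}], because the only factors of [x^n] are [u x^i] with [u] a unit of
    [A]; moreover [x^i - 1] divides [x^j - 1] iff [i] divides [j], so addition
    and multiplication of exponents are definable from [x]. The indeterminate
    [x] itself is not definable; instead quantify over all [t] satisfying a
    finite list of closure properties that hold for [x] and that force
    every [t^n] to be a power of [t]. A nonnegative integer [n] is coded by
    [(s, s^n)], with [s] a nonunit nonzerodivisor: [u = s^n] iff for all such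
    [t] some power [v] of [t] satisfies "[y - s] divides [y^n - u] for every
    power [y] of [t]", where [n] is the exponent of [v]. At [t = x], taking
    [y = x^k] with [k] large makes [y - s] monic of degree exceeding that of
    [s^n - u], whence [u = s^n]; this excludes nonstandard elements. *)

Set Implicit Arguments.
Unset Strict Implicit.
Unset Printing Implicit Defensive.

Import GRing.Theory.
Local Open Scope fset_scope.
Local Open Scope ring_scope.

(** * Factors of powers of the indeterminate *)

Section ReducedIndecomposable.
Variable A : comNzRingType.
Hypothesis Ared : reduced A.

Lemma reduced_sq (x : A) : x * x = 0 -> x = 0.
Proof. by rewrite -expr2; exact: Ared. Qed.

(* If [s] is extreme among the degrees that still matter, multiplying the
   coefficient of degree [s] by one of its terms [p_i q_j] kills every other
   term, so [(p_i q_j)^2 = 0]. *)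
Lemma reduced_coef_step (p q : {poly A}) (s i j : nat) :
  (p * q)`_s = 0 -> (i + j = s)%N ->
  (forall i' j', (i' + j' = s)%N -> i' != i ->
     p`_i * q`_j' = 0 \/ p`_i' * q`_j = 0) ->
  p`_i * q`_j = 0.
Proof.
move=> h ijs vanish; apply: reduced_sq.
have ls : (i < s.+1)%N by lia.
have sij : (s - i)%N = j by lia.
have := congr1 (fun z => p`_i * q`_j * z) h; rewrite mulr0 coefM.
rewrite (bigD1 (Ordinal ls)) //= sij mulrDr big_distrr /= big1 ?addr0 // => k neq_ki.
have ne : val k != i by [].
have e : (k + (s - k) = s)%N by have := ltn_ord k; lia.
have -> : p`_i * q`_j * (p`_k * q`_(s - k)) = (p`_i * q`_(s - k)) * (p`_k * q`_j) by ring.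
by have [->|->] := vanish _ _ e ne; rewrite ?mul0r ?mulr0.
Qed.

(** Antidiagonals above [n] are cleared downwards from beyond both sizes, those below [n] upwards
    from 0. If [i' + j' = i + j] and [i' != i], then [i + j'] and [i' + j] lie on opposite sides of
    [i + j], so one of the two products is already known to vanish. *)
Lemma reduced_mul_coef_eq0 (p q : {poly A}) (n i j : nat) :
  p * q = 'X^n -> (i + j != n)%N -> p`_i * q`_j = 0.
Proof.
move=> pq.
have coef0 s : (s != n)%N -> (p * q)`_s = 0.
  by move=> /negPf sn; rewrite pq coefXn sn.
have high d : forall i j, (n < i + j)%N -> (size p + size q <= i + j + d)%N ->
    p`_i * q`_j = 0.
  elim: d => [|d IHd] i0 j0 lt_n le_d.
    have [le_p|lt_p] := leqP (size p) i0; first by rewrite nth_default ?mul0r.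
    by rewrite [q`_j0]nth_default ?mulr0 //; move: (size p) (size q) le_d lt_p => *; lia.
  apply: (@reduced_coef_step p q (i0 + j0)%N) => //; first by apply: coef0; lia.
  move=> i' j' ijs neq; have [lt|ge] := ltnP i' i0.
    by left; apply: IHd; lia.
  by right; apply: IHd; lia.
have low : forall s i j, (i + j < s)%N -> (s <= n)%N -> p`_i * q`_j = 0.
  elim=> [//|s IHs] i0 j0 lt_s le_n.
  have [lt|ge] := ltnP (i0 + j0) s; first by apply: IHs; lia.
  have ijs : (i0 + j0 = s)%N by lia.
  apply: (@reduced_coef_step p q s) => //; first by apply: coef0; lia.
  move=> i' j' ijs' neq; have [lt|ge'] := ltnP i' i0.
    by right; apply: IHs; lia.
  by left; apply: IHs; lia.
by case: (ltngtP (i + j) n) => // [lt|gt] _;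
  [apply: (low n)|apply: (high (size p + size q)%N)]; lia.
Qed.

(** No power of a nonzero leading coefficient vanishes, so leading coefficients multiply along the
    powers of [p]. *)
Lemma reduced_poly : reduced {poly A}.
Proof.
move=> p n; have [-> //|p0] := eqVneq p 0.
have lead_neq0 m : lead_coef p ^+ m != 0.
  by apply/eqP => /Ared/eqP; rewrite lead_coef_eq0 (negPf p0).
suff lead m : lead_coef (p ^+ m) = lead_coef p ^+ m.
  by move/(congr1 lead_coef)/eqP; rewrite lead lead_coef0 (negPf (lead_neq0 n)).
elim: m => [|m IHm]; first by rewrite !expr0 lead_coef1.
by rewrite !exprS lead_coef_proper_mul IHm -?exprS.
Qed.

Hypothesis Aind : indecomposable A.

(** The square of a nonzero leading coefficient is nonzero, so squaring doubles the degree; an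
    idempotent is therefore constant. *)
Lemma indecomposable_poly : indecomposable {poly A}.
Proof.
move=> e ee; have [lt1|le1] := ltnP 1 (size e).
  have : lead_coef e * lead_coef e != 0.
    apply/eqP => /reduced_sq/eqP; rewrite lead_coef_eq0 => /eqP e0.
    by rewrite e0 size_poly0 in lt1.
  by move/size_proper_mul; rewrite ee; lia.
have := size1_polyC le1; move: (e`_0) => c eC; move: ee; rewrite eC -polyCM.
by move/polyC_inj/Aind=> [->|->]; [left|right].
Qed.

(** Multiplying the sum by [e i] shows [e i] idempotent; if none were 1, all would be 0 and so would
    the sum. *)
Lemma indecomposable_orthogonal_sum (n : nat) (e : 'I_n -> A) :
  (forall i j, i != j -> e i * e j = 0) -> \sum_i e i = 1 -> exists i, e i = 1.
Proof.
move=> orth sum1.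
have idem i : e i * e i = e i.
  rewrite -{3}[e i]mulr1 -sum1 big_distrr /= (bigD1 i) //= big1 ?addr0 // => j neq.
  by apply: orth; rewrite eq_sym.
apply: NNPP => none; move/eqP: sum1; rewrite big1 ?(negPf (oner_neq0 A)) 1?eq_sym //.
  by rewrite oner_eq0.
by move=> i _; case: (Aind (idem i)) => // ei1; case: none; exists i.
Qed.

(* The products [p_i q_(n-i)] are orthogonal idempotents with sum 1, so one of
   them is 1; its factors are units and annihilate all other coefficients. *)
Lemma poly_factor_Xn (p q : {poly A}) (n : nat) : p * q = 'X^n ->
  exists i a b, p = a%:P * 'X^i /\ a * b = 1.
Proof.
move=> pq; have van := reduced_mul_coef_eq0 pq.
have [||i ei] := @indecomposable_orthogonal_sum n.+1 (fun i => p`_i * q`_(n - i)).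
- move=> i j neq.
  have -> : p`_i * q`_(n - i) * (p`_j * q`_(n - j))
          = (p`_i * q`_(n - j)) * (p`_j * q`_(n - i)) by ring.
  rewrite van ?mul0r //; have := ltn_ord j; have := ltn_ord i.
  by move: neq; rewrite -val_eqE /=; lia.
- by rewrite -coefM pq coefXn eqxx.
exists (val i), p`_i, q`_(n - i); split=> //; apply/polyP => k.
rewrite coefCM coefXn; have [->|neq] := eqVneq k i; first by rewrite mulr1.
rewrite mulr0 -[p`_k]mulr1 -ei mulrCA van ?mulr0 //.
by have := ltn_ord i; lia.
Qed.

End ReducedIndecomposable.

(** * Definable powers and arithmetic of exponents *)

Section Powers.
Variable R : comNzRingType.
Implicit Types a b c d s t u v w y z : R.

Definition divides a b : Prop := exists c, b = a * c.

Definition is_power t v : Prop :=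
  (forall d, divides d v -> divides d 1 \/ divides t d) /\ divides (t - 1) (v - 1).

(* For [a = t^k] and [l = t^m] this says [m = lcm(k, k+1) = k(k+1)], because
   [t^i - 1] divides [t^j - 1] exactly when [i] divides [j]. *)
Definition is_pronic t a l : Prop :=
  is_power t l /\ divides (a - 1) (l - 1) /\ divides (t * a - 1) (l - 1) /\
  forall m, is_power t m -> divides (a - 1) (m - 1) ->
    divides (t * a - 1) (m - 1) -> divides (l - 1) (m - 1).

(* [(i+j)(i+j+1) = i(i+1) + j(j+1) + 2ij], read on exponents. *)
Definition is_prod t a b c : Prop :=
  is_power t c /\ exists l1 l2 l3,
    is_pronic t a l1 /\ is_pronic t b l2 /\ is_pronic t (a * b) l3 /\
    l3 = l1 * l2 * (c * c).

(** The last two clauses are the recursion [m * 0 = 0], [m * (n + 1) = m * n + m] on exponents;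
    induction then gives the exponent product of any power [y] with every [t ^+ n]. *)
Definition is_base t : Prop :=
  is_power t 1 /\
  (forall v w, is_power t v -> is_power t w -> is_power t (v * w)) /\
  is_power t t /\
  (forall y, is_power t y -> is_prod t y 1 1) /\
  (forall y v z, is_power t y -> is_power t v -> is_prod t y v z ->
     is_prod t y (t * v) (y * z)).

Definition encodes t s u v : Prop :=
  is_power t v /\ forall y, is_power t y ->
    exists z, is_prod t y v z /\ divides (y - s) (z - u).

Definition regular_nonunit s : Prop :=
  (forall w, s * w <> 1) /\ (forall w, s * w = 0 -> w = 0).

(** The triple [(s, s ^+ m, s ^+ n)] codes the integer [m - n]. *)
Definition in_dom s a b : Prop :=
  regular_nonunit s /\ forall t, is_base t -> exists v w, encodes t s a v /\ encodes t s b w.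

(** On exponents: [m1 + n2 = m2 + n1], subtraction being avoided. Quantifying over all bases
    replaces naming the indeterminate. *)
Definition same_int s1 a1 b1 s2 a2 b2 : Prop :=
  forall t, is_base t -> exists v1 w1 v2 w2,
    encodes t s1 a1 v1 /\ encodes t s1 b1 w1 /\
    encodes t s2 a2 v2 /\ encodes t s2 b2 w2 /\ v1 * w2 = v2 * w1.

Definition sum_int s1 a1 b1 s2 a2 b2 s3 a3 b3 : Prop :=
  forall t, is_base t -> exists v1 w1 v2 w2 v3 w3,
    encodes t s1 a1 v1 /\ encodes t s1 b1 w1 /\
    encodes t s2 a2 v2 /\ encodes t s2 b2 w2 /\
    encodes t s3 a3 v3 /\ encodes t s3 b3 w3 /\ v1 * v2 * w3 = v3 * (w1 * w2).

(** On exponents: [m1 m2 + n1 n2 + n3 = m3 + (m1 n2 + n1 m2)]. *)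
Definition prod_int s1 a1 b1 s2 a2 b2 s3 a3 b3 : Prop :=
  forall t, is_base t -> exists v1 w1 v2 w2 v3 w3,
    encodes t s1 a1 v1 /\ encodes t s1 b1 w1 /\
    encodes t s2 a2 v2 /\ encodes t s2 b2 w2 /\
    encodes t s3 a3 v3 /\ encodes t s3 b3 w3 /\
    exists p q p' q', is_prod t v1 v2 p /\ is_prod t w1 w2 q /\
      is_prod t v1 w2 p' /\ is_prod t w1 v2 q' /\ p * q * w3 = v3 * (p' * q').

Lemma dividesX a i j : (i %| j)%N -> divides (a ^+ i - 1) (a ^+ j - 1).
Proof.
move=> /dvdnP[k ->]; exists (\sum_(h < k) (a ^+ i) ^+ h).
by rewrite mulnC exprM subrX1.
Qed.

Lemma is_power_expr t v n : is_base t -> is_power t v -> is_power t (v ^+ n).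
Proof.
by move=> [pow1 [powM _]] pow_v; elim: n => [|n IHn] //; rewrite exprS; apply: powM.
Qed.

Lemma is_base_power t n : is_base t -> is_power t (t ^+ n).
Proof. by move=> base_t; apply: is_power_expr => //; case: base_t => _ [_ []]. Qed.

Lemma is_base_prod t y n : is_base t -> is_power t y -> is_prod t y (t ^+ n) (y ^+ n).
Proof.
move=> base_t pow_y; have [_ [_ [_ [prod1 prodS]]]] := base_t.
elim: n => [|n IHn]; first exact: prod1.
by rewrite !exprS; apply: prodS => //; exact: is_base_power.
Qed.

Lemma is_base_encodes t s n : is_base t -> encodes t s (s ^+ n) (t ^+ n).
Proof.
move=> base_t; split=> [|y pow_y]; first exact: is_base_power.
exists (y ^+ n); split; first exact: is_base_prod.
by rewrite subrXX; eexists.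
Qed.

(** Cancelling the regular [s] from both sides would leave [1 = s ^+ k.+1], making [s] a unit. *)
Lemma regular_nonunit_expI s m n : regular_nonunit s -> s ^+ m = s ^+ n -> m = n.
Proof.
move=> [unitP regP]; wlog le_mn : m n / (m <= n)%N.
  by move=> H e; case/orP: (leq_total m n) => le; [|symmetry]; apply: H.
rewrite -(subnKC le_mn); case: (n - m)%N => [|k]; first by rewrite addn0.
elim: m {le_mn} => [|m IHm] e.
  by case: (unitP (s ^+ k)); rewrite -exprS -[k.+1]add0n -e.
have : s * (s ^+ m - s ^+ (m + k.+1)) = 0.
  by rewrite mulrBr -!exprS -addSn -e subrr.
by move/regP/eqP; rewrite subr_eq0 => /eqP/IHm; lia.
Qed.

End Powers.

(** * The definable notions at the indeterminate *)

Section PolyX.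
Variable A : comNzRingType.
Hypotheses (Ared : reduced A) (Aind : indecomposable A).
Local Notation X := ('X : {poly A}).

Lemma polyXn_inj : injective (fun n => X ^+ n).
Proof. by move=> m n /(congr1 (size \o val)) /=; rewrite !size_polyXn => -[]. Qed.

Lemma divides_polyX_sub1 (p : {poly A}) : divides (X - 1) (p - 1) <-> p.[1] = 1.
Proof.
split=> [[q /(congr1 (horner^~ 1))]|p1].
  by rewrite !hornerE subrr mul0r => /eqP; rewrite subr_eq0 => /eqP.
have /factor_theorem[q ->] : root (p - 1) 1 by rewrite rootE !hornerE p1 subrr.
by exists q; rewrite mulrC polyC1.
Qed.

(** Taking [d = p] in the divisor clause, [p] is a unit or [X * q], where the smaller [q] inherits
    both clauses. Evaluation at 1 forces the remaining unit coefficient to be 1. *)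
Lemma is_power_polyX (p : {poly A}) : is_power X p <-> exists n, p = X ^+ n.
Proof.
split=> [[]|[n ->]]; last first.
  split=> [d [e /esym/(poly_factor_Xn Ared Aind)[[|i] [a [b [-> ab]]]]]|].
  - by left; exists b%:P; rewrite mulr1 -polyCM ab.
  - by right; exists (a%:P * X ^+ i); rewrite exprS mulrCA.
  - by apply/divides_polyX_sub1; rewrite hornerXn expr1n.
move=> div_p /divides_polyX_sub1.
have [n] := ubnP (size p); elim: n => // n IHn in p div_p *.
move=> le_n p1; have pn0 : p != 0.
  by apply/eqP => p0; move/eqP: p1; rewrite p0 horner0 eq_sym oner_eq0.
have [] := div_p p; first by exists 1; rewrite mulr1.
  move=> [q]; rewrite -[1](expr0 'X) => /esym/(poly_factor_Xn Ared Aind)[i [a [b [ep ab]]]].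
  by exists i; move: p1; rewrite ep hornerM hornerC hornerXn expr1n mulr1 => ->; rewrite mul1r.
move=> [q e]; have qn0 : q != 0 by apply/eqP => q0; rewrite e q0 mulr0 eqxx in pn0.
have [|||m eq] := IHn q; last by exists m.+1; rewrite e eq exprS.
- by move=> d [c eq_q]; apply: div_p; exists (X * c); rewrite e eq_q mulrCA.
- by move: le_n; rewrite e mulrC size_mulX.
- by move: p1; rewrite e hornerM hornerX mul1r.
Qed.

(** Modulo [X ^+ i - 1], [X ^+ j] reduces to [X ^+ r] with [r = j mod i]; a monic divisor of degree
    [i > r] forces [X ^+ r - 1 = 0]. The case [i = 0] is division by 0. *)
Lemma divides_polyXn_sub1 i j : divides (X ^+ i - 1) (X ^+ j - 1) <-> (i %| j)%N.
Proof.
split=> [|/dividesX //]; case: i => [|i] [c].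
  by rewrite subrr mul0r => /eqP; rewrite subr_eq0 -(expr0 X) => /eqP/polyXn_inj ->.
set r := (j %% i.+1)%N; set m := X ^+ i.+1 - 1 => ej.
have [e er] : exists e, X ^+ r - 1 = m * e.
  have [f ef] : divides m (X ^+ (j %/ i.+1 * i.+1) - 1) by apply/dividesX/dvdn_mull.
  exists (c - X ^+ r * f); rewrite mulrBr -ej mulrCA -ef {1}(divn_eq j i.+1) exprD; ring.
have lt_r : (r < i.+1)%N by rewrite ltn_mod.
have mon : m \is monic.
  by rewrite monicE lead_coefDl ?lead_coefXn // size_polyN size_poly1 size_polyXn.
have sm : size m = i.+2 by rewrite size_polyDl size_polyXn // size_polyN size_poly1.
have [e0|e0] := eqVneq e 0.
  move: er; rewrite e0 mulr0 => /eqP; rewrite subr_eq0 -(expr0 X) => /eqP/polyXn_inj r0.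
  by rewrite /dvdn -/r r0.
have := congr1 (fun p : {poly A} => size p) er; rewrite mulrC size_Mmonic // sm.
have : (size (X ^+ r - 1)%R <= r.+1)%N.
  by rewrite (leq_trans (size_polyD _ _)) // size_polyN size_poly1 size_polyXn geq_max leqnn.
by rewrite -size_poly_gt0 in e0; move: (size e) e0 (size _) => *; lia.
Qed.

Lemma lcm_succ k : lcmn k k.+1 = (k * k.+1)%N.
Proof. by rewrite -muln_lcm_gcd (eqP (coprimenS k)) muln1. Qed.

Lemma is_pronic_polyX k (l : {poly A}) : is_pronic X (X ^+ k) l <-> l = X ^+ (k * k.+1).
Proof.
rewrite /is_pronic -exprS -lcm_succ; split.
  move=> [/is_power_polyX[m ->]]; rewrite !divides_polyXn_sub1 => -[km [km1 minl]].
  congr (_ ^+ _); apply/eqP; rewrite eqn_dvd dvdn_lcm km km1 !andbT.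
  apply/divides_polyXn_sub1; apply: minl; first by apply/is_power_polyX; eexists.
    by apply/divides_polyXn_sub1; exact: dvdn_lcml.
  by apply/divides_polyXn_sub1; exact: dvdn_lcmr.
move=> ->; rewrite !divides_polyXn_sub1 dvdn_lcml dvdn_lcmr.
split; first by apply/is_power_polyX; eexists.
do 2 split=> //; move=> m /is_power_polyX[j ->]; rewrite !divides_polyXn_sub1 => kj k1j.
by rewrite dvdn_lcm kj.
Qed.

Lemma is_prod_polyX i j (p : {poly A}) : is_prod X (X ^+ i) (X ^+ j) p <-> p = X ^+ (i * j).
Proof.
split.
  move=> [/is_power_polyX[m ->] [l1 [l2 [l3]]]]; rewrite -exprD !is_pronic_polyX.
  move=> [-> [-> [->]]]; rewrite -!exprD => /polyXn_inj e; congr (_ ^+ _); nia.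
move=> ->; split; first by apply/is_power_polyX; eexists.
exists (X ^+ (i * i.+1)), (X ^+ (j * j.+1)), (X ^+ ((i + j) * (i + j).+1)).
by rewrite -exprD !is_pronic_polyX -!exprD; do 3 split=> //; congr (_ ^+ _); nia.
Qed.

Lemma is_base_polyX : is_base X.
Proof.
split; first by apply/is_power_polyX; exists 0%N.
split.
  move=> v w /is_power_polyX[m ->] /is_power_polyX[n ->]; apply/is_power_polyX.
  by exists (m + n)%N; rewrite exprD.
split; first by apply/is_power_polyX; exists 1%N.
split=> [y /is_power_polyX[m ->]|y v z /is_power_polyX[m ->] /is_power_polyX[n ->]].
  have := is_prod_polyX m 0 1; rewrite muln0 expr0; tauto.
by rewrite is_prod_polyX => ->; rewrite -exprS -exprD is_prod_polyX mulnS.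
Qed.

Lemma encodes_polyX (s u v : {poly A}) :
  encodes X s u v -> exists n, v = X ^+ n /\ u = s ^+ n.
Proof.
move=> [/is_power_polyX[n ->] enc]; exists n; split=> //.
set k := maxn (size s) (size (s ^+ n - u)).
have [|z []] := enc (X ^+ k); first by apply/is_power_polyX; exists k.
rewrite is_prod_polyX => -> [c ec].
have mon : X ^+ k - s \is monic.
  by rewrite monicE lead_coefDl ?lead_coefXn // size_polyN size_polyXn ltnS leq_maxl.
have sz : size (X ^+ k - s) = k.+1.
  by rewrite size_polyDl size_polyXn // size_polyN ltnS leq_maxl.
(* [X ^+ k - s] also divides [(X ^+ k) ^+ n - s ^+ n]; the difference of the two multiples has
   degree below [k]. *)
have [d ed] : divides (X ^+ k - s) (s ^+ n - u).
  exists (c - \sum_(i < n) (X ^+ k) ^+ (n.-1 - i) * s ^+ i).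
  by rewrite mulrBr -ec -subrXX exprM; ring.
apply/esym/eqP; rewrite -subr_eq0 ed; have [->|d0] := eqVneq d 0; first by rewrite mulr0.
have : (size (s ^+ n - u)%R <= k)%N by rewrite leq_maxr.
rewrite ed mulrC size_Mmonic // sz.
by rewrite -size_poly_gt0 in d0; move: (size d) d0 => *; lia.
Qed.

Lemma regular_nonunit_polyX : regular_nonunit X.
Proof.
split=> w.
  by move=> /(congr1 (horner^~ 0)); rewrite !hornerE ?mul0r => /eqP; rewrite eq_sym oner_eq0.
by rewrite mulrC => /eqP; rewrite -size_poly_eq0; have [->//|w0] := eqVneq w 0; rewrite size_mulX.
Qed.

End PolyX.

(** * The interpretation *)

Section Formulas.
Local Notation V := RVar.
Local Notation "x '-t' y" := (RAdd x (ROpp y)) (at level 50).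

(* In each formula builder the variables of index at least [n] are fresh. For
   concrete indices, satisfaction is convertible to the corresponding
   predicate on ring elements defined above. *)
Definition f_divides n (a b : rterm) := FExists n (FEq b (RMul a (V n))).

Definition f_power n (t v : rterm) :=
  FAnd (FForall n (FImp (f_divides n.+1 (V n) v)
          (FOr (f_divides n.+1 (V n) ROne) (f_divides n.+1 t (V n)))))
       (f_divides n (t -t ROne) (v -t ROne)).

Definition f_pronic n (t a l : rterm) :=
  FAnd (f_power n t l) (FAnd (f_divides n (a -t ROne) (l -t ROne))
  (FAnd (f_divides n (RMul t a -t ROne) (l -t ROne))
    (FForall n (FImp (f_power n.+1 t (V n)) (FImp (f_divides n.+1 (a -t ROne) (V n -t ROne))
      (FImp (f_divides n.+1 (RMul t a -t ROne) (V n -t ROne))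
        (f_divides n.+1 (l -t ROne) (V n -t ROne)))))))).

Definition f_prod n (t a b c : rterm) :=
  FAnd (f_power n t c) (FExists n (FExists n.+1 (FExists n.+2
    (FAnd (f_pronic n.+3 t a (V n)) (FAnd (f_pronic n.+3 t b (V n.+1))
      (FAnd (f_pronic n.+3 t (RMul a b) (V n.+2))
        (FEq (V n.+2) (RMul (RMul (V n) (V n.+1)) (RMul c c))))))))).

Definition f_base n (t : rterm) :=
  FAnd (f_power n t ROne) (FAnd
  (FForall n (FForall n.+1 (FImp (f_power n.+2 t (V n)) (FImp (f_power n.+2 t (V n.+1))
     (f_power n.+2 t (RMul (V n) (V n.+1))))))) (FAnd
  (f_power n t t) (FAnd
  (FForall n (FImp (f_power n.+1 t (V n)) (f_prod n.+1 t (V n) ROne ROne)))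
  (FForall n (FForall n.+1 (FForall n.+2 (FImp (f_power n.+3 t (V n))
    (FImp (f_power n.+3 t (V n.+1)) (FImp (f_prod n.+3 t (V n) (V n.+1) (V n.+2))
       (f_prod n.+3 t (V n) (RMul t (V n.+1)) (RMul (V n) (V n.+2)))))))))))).

Definition f_encodes n (t s u v : rterm) :=
  FAnd (f_power n t v) (FForall n (FImp (f_power n.+1 t (V n)) (FExists n.+1
    (FAnd (f_prod n.+2 t (V n) v (V n.+1))
      (f_divides n.+2 (V n -t s) (V n.+1 -t u)))))).

Definition f_regular_nonunit n (s : rterm) :=
  FAnd (FForall n (FNot (FEq (RMul s (V n)) ROne)))
       (FForall n (FImp (FEq (RMul s (V n)) RZero) (FEq (V n) RZero))).

Definition f_dom :=
  FAnd (f_regular_nonunit 3 (V 0)) (FForall 3 (FImp (f_base 4 (V 3)) (FExists 4 (FExists 5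
    (FAnd (f_encodes 6 (V 3) (V 0) (V 1) (V 4)) (f_encodes 6 (V 3) (V 0) (V 2) (V 5))))))).

Definition f_eq :=
  FForall 6 (FImp (f_base 7 (V 6)) (FExists 7 (FExists 8 (FExists 9 (FExists 10
    (FAnd (f_encodes 11 (V 6) (V 0) (V 1) (V 7))
    (FAnd (f_encodes 11 (V 6) (V 0) (V 2) (V 8))
    (FAnd (f_encodes 11 (V 6) (V 3) (V 4) (V 9))
    (FAnd (f_encodes 11 (V 6) (V 3) (V 5) (V 10))
      (FEq (RMul (V 7) (V 10)) (RMul (V 9) (V 8)))))))))))).

Definition f_ternary (g : rformula) :=
  FForall 9 (FImp (f_base 10 (V 9))
    (FExists 10 (FExists 11 (FExists 12 (FExists 13 (FExists 14 (FExists 15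
    (FAnd (f_encodes 16 (V 9) (V 0) (V 1) (V 10))
    (FAnd (f_encodes 16 (V 9) (V 0) (V 2) (V 11))
    (FAnd (f_encodes 16 (V 9) (V 3) (V 4) (V 12))
    (FAnd (f_encodes 16 (V 9) (V 3) (V 5) (V 13))
    (FAnd (f_encodes 16 (V 9) (V 6) (V 7) (V 14))
    (FAnd (f_encodes 16 (V 9) (V 6) (V 8) (V 15)) g))))))))))))).

Definition f_sum := f_ternary
  (FEq (RMul (RMul (V 10) (V 12)) (V 15)) (RMul (V 14) (RMul (V 11) (V 13)))).

Definition f_mul := f_ternary
  (FExists 16 (FExists 17 (FExists 18 (FExists 19
    (FAnd (f_prod 20 (V 9) (V 10) (V 12) (V 16))
    (FAnd (f_prod 20 (V 9) (V 11) (V 13) (V 17))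
    (FAnd (f_prod 20 (V 9) (V 10) (V 13) (V 18))
    (FAnd (f_prod 20 (V 9) (V 11) (V 12) (V 19))
      (FEq (RMul (RMul (V 16) (V 17)) (V 15))
           (RMul (V 14) (RMul (V 18) (V 19)))))))))))).

Definition arith_interp : interp_data := InterpData 3 f_dom f_eq f_sum f_mul.

End Formulas.

(** * Correctness of the interpretation over univariate polynomials *)

Section Interpretation.
Variable A : comNzRingType.
Hypotheses (Ared : reduced A) (Aind : indecomposable A).
Local Notation P := {poly A}.
Local Notation X := ('X : P).

Definition int_code (s a b : P) (z : int) : Prop :=
  exists m n, a = s ^+ m /\ b = s ^+ n /\ z = m%:Z - n%:Z.

(** The interpretation map must be total, so the integer is chosen; it is pinned down only for a
    regular nonunit [s] and powers of it. *)
Definition decode (s a b : P) : int :=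
  epsilon (inhabits 0) (int_code s a b).

Lemma decodeE (s : P) m n : regular_nonunit s -> decode s (s ^+ m) (s ^+ n) = m%:Z - n%:Z.
Proof.
move=> rs; have : int_code s (s ^+ m) (s ^+ n) (decode s (s ^+ m) (s ^+ n)).
  by apply: epsilon_spec; exists (m%:Z - n%:Z), m, n.
by move=> [m' [n' [/(regular_nonunit_expI rs) <- [/(regular_nonunit_expI rs) <- ->]]]].
Qed.

Let baseX := is_base_polyX Ared Aind.

(** The base [X] alone forces [a] and [b] to be powers of [s]; conversely [t ^+ m] and [t ^+ n] are
    witnesses at every base [t]. The relations below follow the same pattern. *)
Lemma in_domP (s a b : P) :
  in_dom s a b <-> regular_nonunit s /\ exists m n, a = s ^+ m /\ b = s ^+ n.
Proof.
split=> [[rs /(_ _ baseX)[v [w [/(encodes_polyX Ared Aind)[m [_ ->]]]]]]|].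
  by move=> /(encodes_polyX Ared Aind)[n [_ ->]]; split=> //; exists m, n.
move=> [rs [m [n [-> ->]]]]; split=> // t base_t.
by exists (t ^+ m), (t ^+ n); split; apply: is_base_encodes.
Qed.

Lemma encodes_polyX_root (s v : P) m : regular_nonunit s -> encodes X s (s ^+ m) v -> v = X ^+ m.
Proof. by move=> rs /(encodes_polyX Ared Aind)[n [-> /(regular_nonunit_expI rs) ->]]. Qed.

Let inX := @polyXn_inj A.

Lemma same_intP (s1 s2 : P) m1 n1 m2 n2 : regular_nonunit s1 -> regular_nonunit s2 ->
  same_int s1 (s1 ^+ m1) (s1 ^+ n1) s2 (s2 ^+ m2) (s2 ^+ n2) <->
  m1%:Z - n1%:Z = m2%:Z - n2%:Z.
Proof.
move=> r1 r2; split.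
  move=> /(_ _ baseX)[v1 [w1 [v2 [w2]]]].
  move=> [/(encodes_polyX_root r1) -> [/(encodes_polyX_root r1) ->]].
  move=> [/(encodes_polyX_root r2) -> [/(encodes_polyX_root r2) ->]].
  by rewrite -!exprD => /inX; lia.
move=> e t base_t; exists (t ^+ m1), (t ^+ n1), (t ^+ m2), (t ^+ n2).
do 4 (split; [exact: is_base_encodes|]).
by rewrite -!exprD; congr (_ ^+ _); lia.
Qed.

Lemma sum_intP (s1 s2 s3 : P) m1 n1 m2 n2 m3 n3 :
  regular_nonunit s1 -> regular_nonunit s2 -> regular_nonunit s3 ->
  sum_int s1 (s1 ^+ m1) (s1 ^+ n1) s2 (s2 ^+ m2) (s2 ^+ n2) s3 (s3 ^+ m3) (s3 ^+ n3) <->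
  (m1%:Z - n1%:Z) + (m2%:Z - n2%:Z) = m3%:Z - n3%:Z.
Proof.
move=> r1 r2 r3; split.
  move=> /(_ _ baseX)[v1 [w1 [v2 [w2 [v3 [w3]]]]]].
  move=> [/(encodes_polyX_root r1) -> [/(encodes_polyX_root r1) ->]].
  move=> [/(encodes_polyX_root r2) -> [/(encodes_polyX_root r2) ->]].
  move=> [/(encodes_polyX_root r3) -> [/(encodes_polyX_root r3) ->]].
  by rewrite -!exprD => /inX; lia.
move=> e t base_t.
exists (t ^+ m1), (t ^+ n1), (t ^+ m2), (t ^+ n2), (t ^+ m3), (t ^+ n3).
do 6 (split; [exact: is_base_encodes|]).
by rewrite -!exprD; congr (_ ^+ _); lia.
Qed.

Lemma prod_intP (s1 s2 s3 : P) m1 n1 m2 n2 m3 n3 :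
  regular_nonunit s1 -> regular_nonunit s2 -> regular_nonunit s3 ->
  prod_int s1 (s1 ^+ m1) (s1 ^+ n1) s2 (s2 ^+ m2) (s2 ^+ n2) s3 (s3 ^+ m3) (s3 ^+ n3) <->
  (m1%:Z - n1%:Z) * (m2%:Z - n2%:Z) = m3%:Z - n3%:Z.
Proof.
move=> r1 r2 r3; split.
  move=> /(_ _ baseX)[v1 [w1 [v2 [w2 [v3 [w3]]]]]].
  move=> [/(encodes_polyX_root r1) -> [/(encodes_polyX_root r1) ->]].
  move=> [/(encodes_polyX_root r2) -> [/(encodes_polyX_root r2) ->]].
  move=> [/(encodes_polyX_root r3) -> [/(encodes_polyX_root r3) ->]].
  move=> [p [q [p' [q']]]]; rewrite !(is_prod_polyX Ared Aind).
  by move=> [-> [-> [-> [->]]]]; rewrite -!exprD => /inX; nia.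
move=> e t base_t.
exists (t ^+ m1), (t ^+ n1), (t ^+ m2), (t ^+ n2), (t ^+ m3), (t ^+ n3).
do 6 (split; [exact: is_base_encodes|]).
have pr i j : is_prod t (t ^+ i) (t ^+ j) (t ^+ (i * j)).
  by rewrite exprM; apply: is_base_prod => //; apply: is_base_power.
exists (t ^+ (m1 * m2)), (t ^+ (n1 * n2)), (t ^+ (m1 * n2)), (t ^+ (n1 * m2)).
do 4 (split; [exact: pr|]).
by rewrite -!exprD; congr (_ ^+ _); nia.
Qed.

Lemma interprets_Z_poly : interprets_Z P arith_interp.
Proof.
exists (fun x => decode (tnth x ord0) (tnth x (inord 1)) (tnth x (inord 2))).
have tupleP3 (x : 3.-tuple P) : exists s a b, x = [tuple s; a; b].
  case: x => -[|s [|a [|b [|c r]]]] // i; exists s, a, b; exact: val_inj.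
have domP (s a b : P) : rholds (senv [tuple s; a; b]) (idom arith_interp) ->
    regular_nonunit s /\ exists m n, a = s ^+ m /\ b = s ^+ n.
  (* Satisfaction of [f_dom] is convertible to [in_dom s a b]. *)
  by move=> d; exact/in_domP.
have val3 (s a b : P) : decode (tnth [tuple s; a; b] ord0)
   (tnth [tuple s; a; b] (inord 1)) (tnth [tuple s; a; b] (inord 2)) = decode s a b.
  by rewrite !(tnth_nth 0) /= !inordK.
split.
  move=> z; have [m [n ez]] : exists m n : nat, z = m%:Z - n%:Z.
    case: z => k; first by exists k, 0%N; rewrite subr0.
    by exists 0%N, k.+1; rewrite sub0r NegzE.
  exists [tuple X; X ^+ m; X ^+ n]; split; last first.
    by rewrite val3 decodeE ?ez //; exact: regular_nonunit_polyX.
  by apply: (proj2 (in_domP X (X ^+ m) (X ^+ n))); split; [exact: regular_nonunit_polyX|exists m, n].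
split.
  move=> x y; have [s1 [a1 [b1 ->]]] := tupleP3 x; have [s2 [a2 [b2 ->]]] := tupleP3 y.
  move=> /domP[r1 [m1 [n1 [-> ->]]]] /domP[r2 [m2 [n2 [-> ->]]]].
  by rewrite !val3 !decodeE //; exact: same_intP.
split=> x y z; have [s1 [a1 [b1 ->]]] := tupleP3 x;
  have [s2 [a2 [b2 ->]]] := tupleP3 y; have [s3 [a3 [b3 ->]]] := tupleP3 z;
  move=> /domP[r1 [m1 [n1 [-> ->]]]] /domP[r2 [m2 [n2 [-> ->]]]] /domP[r3 [m3 [n3 [-> ->]]]];
  rewrite !val3 !decodeE //.
- exact: sum_intP.
- exact: prod_intP.
Qed.

End Interpretation.

(** * Invariance under ring isomorphism *)

Section Transfer.
Variables (R S : comNzRingType) (f : {rmorphism R -> S}).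
Hypothesis f_bij : bijective f.

Lemma reval_rmorph (e : nat -> R) t : reval (f \o e) t = f (reval e t).
Proof.
elim: t => //= [||t1 -> t2 ->|t ->|t1 -> t2 ->];
  by rewrite ?(rmorph0, rmorph1, rmorphD, rmorphN, rmorphM).
Qed.

Lemma eq_rholds (T : comNzRingType) (e e' : nat -> T) g :
  e =1 e' -> rholds e g <-> rholds e' g.
Proof.
move=> ee'.
by have -> : e = e' by apply: functional_extensionality.
Qed.

(** Injectivity of [f] handles equations, surjectivity the quantifiers. *)
Lemma rholds_rmorph (e : nat -> R) g : rholds (f \o e) g <-> rholds e g.
Proof.
have upd_comp (h : nat -> R) i x : upd (f \o h) i (f x) =1 f \o upd h i x.
  by move=> j; rewrite /upd /=; case: eqP.
have [f' fK f'K] := f_bij.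
elim: g e => [t u|//|g IHg|g IHg h IHh|g IHg h IHh|g IHg h IHh|i g IHg|i g IHg] e /=.
- by rewrite !reval_rmorph; split=> [/(bij_inj f_bij)|->].
- by rewrite IHg.
- by rewrite IHg IHh.
- by rewrite IHg IHh.
- by rewrite IHg IHh.
- split=> [[y hy]|[x hx]].
    by exists (f' y); apply/IHg; move: hy; rewrite -{1}(f'K y) (eq_rholds _ (upd_comp _ _ _)).
  by exists (f x); rewrite (eq_rholds _ (upd_comp _ _ _)) IHg.
- split=> [hall x|hall y].
    by apply/IHg; rewrite -(eq_rholds _ (upd_comp _ _ _)).
  by rewrite -(f'K y) (eq_rholds _ (upd_comp _ _ _)) IHg.
Qed.

Lemma interprets_Z_iso I : interprets_Z R I -> interprets_Z S I.
Proof.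
have [f' fK f'K] := f_bij.
have hs (s : seq S) g : rholds (senv (map f' s)) g <-> rholds (senv s) g.
  rewrite -rholds_rmorph; apply: eq_rholds => i; rewrite /senv /=.
  have [lt|ge] := ltnP i (size s); first by rewrite (nth_map 0) ?f'K.
  (* Beyond the tuple both environments hold the default 0, which [f] preserves. *)
  by rewrite !nth_default ?rmorph0 ?size_map.
move=> [v [surj [eqP [sumP mulP]]]]; exists (fun x => v (map_tuple f' x)).
split=> [n|].
  have [x [dx vx]] := surj n; exists (map_tuple f x); split.
    by apply/hs; rewrite /= -map_comp (eq_map (g := id)) ?map_id //.
  by rewrite -vx; congr v; apply: val_inj; rewrite /= -map_comp (eq_map (g := id)) ?map_id.
split=> [x y /hs dx /hs dy|].
  by rewrite -hs map_cat; exact: (eqP (map_tuple f' x) (map_tuple f' y)).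
split=> x y z /hs dx /hs dy /hs dz; rewrite -hs !map_cat.
  exact: (sumP (map_tuple f' x) (map_tuple f' y) (map_tuple f' z)).
exact: (mulP (map_tuple f' x) (map_tuple f' y) (map_tuple f' z)).
Qed.

End Transfer.

Local Notation "'U_(' i )" := (ucm i) : monom_scope.

(** * Polynomial rings in arbitrary sets of indeterminates *)

Section Evaluation.
Variables (I : choiceType) (T : comNzRingType).

Definition monom_eval (g : I -> T) (m : {cmonom I}) : T :=
  \prod_(i <- finsupp m) g i ^+ m i.

Lemma monom_evalEw g (m : {cmonom I}) (d : {fset I}) : finsupp m `<=` d ->
  monom_eval g m = \prod_(i <- d) g i ^+ m i.
Proof.
move=> le; rewrite /monom_eval (big_fset_incl _ le) // => i _.
by rewrite -cmE_eq0 => /eqP ->; rewrite expr0.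
Qed.

Lemma monom_eval_is_multiplicative g : mmorphism (monom_eval g).
Proof.
split=> [m n|]; last by rewrite /monom_eval mdom1 big_seq_fset0.
rewrite !(@monom_evalEw _ _ (finsupp m `|` finsupp n)) ?fsubsetUl ?fsubsetUr ?mdomD //.
by rewrite -big_split /=; apply: eq_bigr => i _; rewrite cmM exprD.
Qed.

HB.instance Definition _ g := monalg.isMultiplicative.Build {cmonom I} T (monom_eval g)
  (monom_eval_is_multiplicative g).

Lemma monom_evalU g i : monom_eval g U_(i)%M = g i.
Proof. by rewrite /monom_eval mdomU big_seq_fset1 cmUU expr1. Qed.

Variable B : comNzRingType.

Definition poly_eval (c : {rmorphism B -> T}) (g : I -> T) : {rmorphism polyring B I -> T} :=
  mmap c (monom_eval g).

Lemma poly_evalC c g b : poly_eval c g b%:MP = c b.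
Proof. exact: mmapC. Qed.

Lemma poly_evalU c g i : poly_eval c g << U_(i)%M >> = g i.
Proof.
transitivity (c 1 * monom_eval g U_(i)%M); first exact: mmapU.
by rewrite rmorph1 mul1r monom_evalU.
Qed.

End Evaluation.

Section Hom.
Variables (I : choiceType) (T B : comNzRingType).

(** The product is moved inside the monomial monoid, where exponents are compared at each [j]. It
    makes homomorphisms determined by constants and indeterminates. *)
Lemma malgU_prod (m : {cmonom I}) :
  << m >> = \prod_(i <- finsupp m) << U_(i)%M >> ^+ m i :> polyring B I.
Proof.
have mulU (k1 k2 : {cmonom I}) : << k1 >> * << k2 >> = << mmul k1 k2 >> :> polyring B I.
  by have := @fgmulUU _ B 1 1 k1 k2; rewrite mulr1 => <-; rewrite -malgM_def.
have expU (k : {cmonom I}) n : << k >> ^+ n = << iter n (mmul k) mone >> :> polyring B I.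
  elim: n => [|n IHn]; first by rewrite expr0 -[LHS]mpolyC1E; reflexivity.
  by rewrite exprS IHn mulU; reflexivity.
have -> : \prod_(i <- finsupp m) << U_(i)%M >> ^+ m i =
    << \big[mmul/mone]_(i <- finsupp m) iter (m i) (mmul U_(i)%M) mone >> :> polyring B I.
  elim/big_rec2: _ => [|i y1 y2 _ ->]; first by rewrite -[LHS]mpolyC1E; reflexivity.
  by rewrite expU mulU; reflexivity.
congr (<< _ >>); apply/eqP/cmP => j.
have iterE n (k : {cmonom I}) : (iter n (mmul k) mone) j = (n * k j)%N.
  by elim: n => [|n IHn] /=; rewrite ?cm1 // cmM IHn mulSn.
have -> : (\big[mmul/mone]_(i <- finsupp m) iter (m i) (mmul U_(i)%M) mone) j =
    (\sum_(i <- finsupp m) m i * (i == j))%N.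
  elim/big_rec2: _ => [|i y1 y2 _ <-]; first exact: cm1.
  by rewrite cmM iterE cmU.
case: (boolP (j \in finsupp m)) => jm; last first.
  move: (jm); rewrite -cmE_eq0 => /eqP ->; rewrite big_seq big1 // => i im.
  by case: eqP => [ij|_]; [rewrite ij (negPf jm) in im|rewrite muln0].
rewrite (big_fsetD1 j) //= eqxx muln1 big_seq big1 ?addn0 // => i.
by rewrite in_fsetD1 => /andP[/negPf -> _]; rewrite muln0.
Qed.

Lemma polyring_hom_ext (f g : {rmorphism polyring B I -> T}) :
  (forall b, f b%:MP = g b%:MP) -> (forall i, f << U_(i)%M >> = g << U_(i)%M >>) -> f =1 g.
Proof.
move=> eqC eqU p; rewrite [p]monalgE !rmorph_sum; apply: eq_bigr => m _.
have -> : << p@_m *g m >> = (p@_m)%:MP * << m >> :> polyring B I.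
  by have := @fgmulUU _ B (p@_m) 1 mone m; rewrite mulr1 mul1m => <-; rewrite -malgM_def.
have eU : f << m >> = g << m >>.
  rewrite malgU_prod (rmorph_prod f) (rmorph_prod g); apply: eq_bigr => i _.
  by rewrite (rmorphXn f) (rmorphXn g) (eqU i); reflexivity.
exact: (etrans (rmorphM f _ _) (etrans (congr2 *%R (eqC _) eU) (esym (rmorphM g _ _)))).
Qed.

Lemma poly_hom_ext (f g : {rmorphism {poly B} -> T}) :
  (forall b, f b%:P = g b%:P) -> f 'X = g 'X -> f =1 g.
Proof.
move=> eqC eqX p; rewrite -[p]coefK poly_def !rmorph_sum; apply: eq_bigr => i _.
by rewrite -mul_polyC !rmorphM !rmorphXn eqC eqX.
Qed.

End Hom.

(** * Splitting off one indeterminate *)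

Section Isomorphisms.

Lemma ring_iso_cancel (A R : comNzRingType) (f : {rmorphism A -> R}) (g : {rmorphism R -> A}) :
  (g \o f =1 id) -> (f \o g =1 id) -> ring_iso A R.
Proof. by move=> gf fg; exists f, g => x; [exact: gf|exact: fg]. Qed.

Lemma ring_iso_sym (A R : comNzRingType) : ring_iso A R -> ring_iso R A.
Proof.
move=> [f [g fK gK]].
have gA : zmod_morphism g by move=> x y; apply: (can_inj fK); rewrite rmorphB !gK.
have gM : monoid_morphism g.
  by split=> [|x y]; apply: (can_inj fK); rewrite ?rmorphM ?rmorph1 !gK.
pose gz := GRing.isZmodMorphism.Build _ _ g gA.
pose gm := GRing.isMonoidMorphism.Build _ _ g gM.
pose G : {rmorphism R -> A} := HB.pack g gz gm.
by exists G, f.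
Qed.

Lemma ring_iso_trans (A R S : comNzRingType) : ring_iso A R -> ring_iso R S -> ring_iso A S.
Proof. by move=> [f fb] [g gb]; exists (g \o f : {rmorphism _ -> _}); exact: bij_comp. Qed.

Variable B : comNzRingType.

Lemma ring_iso_poly_unit : ring_iso {poly B} (polyring B unit).
Proof.
pose x : polyring B unit := << U_(tt)%M >>.
pose c : {rmorphism B -> polyring B unit} := @mkmalgU {cmonom unit} B mone.
have cx : commr_rmorph c x by move=> b; exact: mulrC.
pose f : {rmorphism {poly B} -> polyring B unit} := horner_morph cx.
pose g : {rmorphism polyring B unit -> {poly B}} := poly_eval (@polyC B) (fun _ => 'X).
have gC b : g b%:MP = b%:P by exact: poly_evalC.
have gU i : g << U_(i)%M >> = 'X by exact: poly_evalU.
have fC b : f b%:P = b%:MP by exact: horner_morphC.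
have fX : f 'X = x by exact: horner_morphX.
apply: (@ring_iso_cancel _ _ f g) => p.
  apply: (poly_hom_ext (f := g \o f) (g := idfun)) => [b|].
    exact: (etrans (congr1 g (fC b)) (gC b)).
  exact: (etrans (congr1 g fX) (gU tt)).
apply: (polyring_hom_ext (f := f \o g) (g := idfun)) => [b|[]].
  exact: (etrans (congr1 f (gC b)) (fC b)).
exact: (etrans (congr1 f (gU tt)) fX).
Qed.

(** The chosen [i0] corresponds to ['X] and the others to constants; both composites are the
    identity on generators. The remaining index set may be empty. *)
Lemma ring_iso_poly_remove (I : choiceType) (i0 : I) :
  ring_iso {poly polyring B {i : I | i != i0}} (polyring B I).
Proof.
pose J : choiceType := {i : I | i != i0}.
pose x : polyring B I := << U_(i0)%M >>.
pose c : {rmorphism polyring B J -> polyring B I} :=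
  poly_eval (@mkmalgU {cmonom I} B mone) (fun j => << U_(val j)%M >>).
have cx : commr_rmorph c x by move=> b; exact: mulrC.
pose f : {rmorphism {poly polyring B J} -> polyring B I} := horner_morph cx.
pose k : {rmorphism B -> {poly polyring B J}} := @polyC (polyring B J) \o @mkmalgU {cmonom J} B mone.
pose g : {rmorphism polyring B I -> {poly polyring B J}} :=
  poly_eval k (fun i => if insub i is Some j then (<< U_(j)%M >> : polyring B J)%:P else 'X).
have gC b : g b%:MP = b%:MP%:P by exact: poly_evalC.
have gx : g x = 'X by rewrite [LHS]poly_evalU insubF ?eqxx.
have gU (j : J) : g << U_(val j)%M >> = << U_(j)%M >>%:P by rewrite [LHS]poly_evalU valK.
have cC b : c b%:MP = b%:MP by exact: poly_evalC.
have cU j : c << U_(j)%M >> = << U_(val j)%M >> by exact: poly_evalU.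
have fC b : f b%:P = c b by exact: horner_morphC.
have fX : f 'X = x by exact: horner_morphX.
apply: (@ring_iso_cancel _ _ f g) => p.
  apply: (poly_hom_ext (f := g \o f) (g := idfun)) => [b|].
    apply: (etrans (congr1 g (fC b))).
    apply: (polyring_hom_ext (f := g \o c) (g := @polyC (polyring B J))) => [a|j].
      exact: (etrans (congr1 g (cC a)) (gC a)).
    exact: (etrans (congr1 g (cU j)) (gU j)).
  exact: (etrans (congr1 g fX) gx).
apply: (polyring_hom_ext (f := f \o g) (g := idfun)) => [b|i].
  exact: (etrans (congr1 f (gC b)) (etrans (fC _) (cC b))).
have [->|neq] := eqVneq i i0; first exact: (etrans (congr1 f gx) fX).
have := etrans (congr1 f (gU (Sub i neq))) (etrans (fC _) (cU _)).
by rewrite SubK.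
Qed.

End Isomorphisms.

(** * Reducedness and indecomposability by Kronecker substitution *)

Section Kronecker.
Variables (I : choiceType) (B : comNzRingType).

(** The weights are powers of [N], so the sum has the [a i] as base [N] digits: the head of [l] has
    weight 1 and is read off modulo [N]. *)
Lemma separating_weight (N : nat) (l : seq I) : uniq l ->
  exists w : I -> nat, forall a b : I -> nat,
    (forall i, a i < N)%N -> (forall i, b i < N)%N ->
    (\sum_(i <- l) w i * a i = \sum_(i <- l) w i * b i)%N -> {in l, a =1 b}.
Proof.
elim: l => [_|j l IHl /= /andP[jl /IHl[w wP]]]; first by exists (fun=> 0%N).
exists (fun i => if i == j then 1%N else (N * w i)%N) => a b aN bN.
have sumE (c : I -> nat) : (\sum_(i <- l) (if i == j then 1 else N * w i) * c i
    = N * \sum_(i <- l) w i * c i)%N.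
  rewrite big_distrr; apply: eq_big_seq => i il /=; case: eqP => [ij|_]; last by rewrite mulnA.
  by rewrite -ij il in jl.
rewrite !big_cons !sumE eqxx !mul1n => e.
have ej : a j = b j.
  have := congr1 (modn^~ N) e.
  by rewrite (addnC (a j)) (addnC (b j)) !(mulnC N) !modnMDl !modn_small.
move=> i; rewrite in_cons => /orP[/eqP -> //|]; apply: wP => //.
have N0 : (0 < N)%N by exact: leq_ltn_trans (aN j).
by move: e; rewrite ej => /addnI/eqP; rewrite eqn_pmul2l // => /eqP.
Qed.

(* Kronecker substitution: sending the variables to suitable powers of ['X]
   separates any given finite set of monomials. *)
Lemma kronecker_substitution (D : {fset {cmonom I}}) :
  exists phi : {rmorphism polyring B I -> {poly B}},
    forall p : polyring B I, msupp p `<=` D -> phi p = 0 -> p = 0.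
Proof.
pose l : {fset I} := \bigcup_(m <- D) finsupp m.
(* The total degree bounds each exponent, so every exponent in [D] is a valid base [N] digit. *)
pose N := (\max_(m <- D) mdeg m).+1.
have supp_l m : m \in D -> finsupp m `<=` l by move=> mD; exact: (bigfcup_sup _ mD).
have lt_N m i : m \in D -> (m i < N)%N.
  move=> mD; rewrite ltnS (leq_trans _ (leq_bigmax_seq _ mD _)) //.
  case: (boolP (i \in finsupp m)) => [im|]; last by rewrite -cmE_eq0 => /eqP ->.
  by rewrite mdegE (big_fsetD1 i) //= leq_addr.
have [w wP] := separating_weight N (fset_uniq l).
pose W (m : {cmonom I}) := (\sum_(i <- l) w i * m i)%N.
have W_inj : {in D &, injective W}.
  move=> m m' mD m'D e; apply/eqP/cmP => i.
  case: (boolP (i \in l)) => [il|il].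
    exact: (wP m m' (fun k => lt_N m k mD) (fun k => lt_N m' k m'D) e).
  have out (k : {cmonom I}) : k \in D -> k i = 0%N.
    move=> kD; apply/eqP; rewrite cmE_eq0; apply: contra il.
    exact: (fsubsetP (supp_l _ kD)).
  by rewrite !out.
exists (poly_eval (@polyC B) (fun i => 'X^(w i))) => p pD.
have phiE : poly_eval (@polyC B) (fun i => 'X^(w i)) p
    = \sum_(m <- msupp p) (p@_m)%:P * 'X^(W m).
  transitivity (\sum_(m <- msupp p) (p@_m)%:P * monom_eval (fun i => 'X^(w i) : {poly B}) m).
    exact: mmapE.
  apply: eq_big_seq => m mp; congr (_ * _).
  have mD := fsubsetP pD _ mp.
  rewrite (monom_evalEw _ (supp_l _ mD)) /W.
  elim/big_rec2: _ => [|i y1 y2 _ ->]; first by rewrite expr0.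
  by rewrite exprD exprM.
rewrite phiE => sum0; apply/malgP => m; rewrite mcoeff0.
case: (boolP (m \in msupp p)) => [mp|]; last exact: mcoeff_outdom.
(* As [W] is injective on [D], only the term of [m] contributes to this coefficient. *)
have := congr1 (fun q : {poly B} => q`_(W m)) sum0.
rewrite coef0 coef_sum (big_fsetD1 m) //= coefCM coefXn eqxx mulr1.
rewrite big_seq big1 ?addr0 // => m'; rewrite in_fsetD1 => /andP[neq m'p].
rewrite coefCM coefXn; case: eqP => [e|_]; last by rewrite mulr0.
by rewrite (W_inj m m') ?eqxx ?(fsubsetP pD) // in neq.
Qed.

Lemma polyring_reduced : reduced B -> reduced (polyring B I).
Proof.
move=> Bred p n pn0; have [phi phiP] := kronecker_substitution (msupp p).
apply: phiP; first exact: fsubset_refl.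
apply: (@reduced_poly B Bred _ n); rewrite -(rmorphXn phi).
exact: (etrans (congr1 phi pn0) (rmorph0 phi)).
Qed.

Lemma polyring_indecomposable : reduced B -> indecomposable B ->
  indecomposable (polyring B I).
Proof.
move=> Bred Bind e ee.
(* Both supports are needed: either [e] or [1 - e] is to be shown zero from its image. *)
have [phi phiP] := kronecker_substitution (msupp e `|` msupp (1 - e : polyring B I)).
have : phi e * phi e = phi e by exact: (etrans (esym (rmorphM phi e e)) (congr1 phi ee)).
move=> /(indecomposable_poly Bred Bind)[e0|e1].
  by left; apply: phiP => //; exact: fsubsetUl.
right; apply/esym/eqP; rewrite -subr_eq0; apply/eqP/phiP; first exact: fsubsetUr.
by rewrite (rmorphB phi) (rmorph1 phi) e1 subrr.
Qed.

End Kronecker.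

(** * The three classes of rings *)

Lemma is_field_fieldType (A : comNzRingType) : is_field A ->
  exists F : fieldType, A = F :> comNzRingType.
Proof.
(* With the structure of [A] exposed, the field packed below coerces back to [A] itself, giving
   equality and not just isomorphism. *)
case: A => T [] >; set A := (X in is_field X) => fieldA.
have [inv invP] : exists inv : A -> A, forall x, (x != 0 -> inv x * x = 1) /\ (x = 0 -> inv x = 0).
  apply: (choice (fun x y : A => (x != 0 -> y * x = 1) /\ (x = 0 -> y = 0))) => x.
  have [->|x0] := eqVneq x 0; first by exists 0.
  by have [y xy] := fieldA x x0; exists y; split=> [_|/eqP]; [rewrite mulrC|rewrite (negPf x0)].
have inv0 : inv 0 = 0 by exact: (invP 0).2.
have mulV x : x != 0 -> inv x * x = 1 by exact: (invP x).1.
pose Fmixin := GRing.ComNzRing_isField.Build A mulV inv0.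
pose F : fieldType := HB.pack (GRing.ComNzRing.sort A) Fmixin.
by exists F.
Qed.

Lemma field_reduced (F : fieldType) : reduced F.
Proof. by move=> x n /eqP; rewrite expf_eq0 => /andP[_ /eqP]. Qed.

Lemma field_indecomposable (F : fieldType) : indecomposable F.
Proof.
move=> e /eqP; rewrite -subr_eq0 -{3}[e]mulr1 -mulrBr mulf_eq0 subr_eq0.
by move=> /orP[] /eqP; [left|right].
Qed.

Lemma red_indec_polyring_poly (R : comNzRingType) : red_indec_polyring R ->
  exists A : comNzRingType, reduced A /\ indecomposable A /\ ring_iso {poly A} R.
Proof.
move=> [B [X [Bred [Bind [[x] isoR]]]]].
exists (polyring B {y : X | y != x}).
split; first exact: polyring_reduced.
split; first exact: polyring_indecomposable.
exact: ring_iso_trans (ring_iso_poly_remove B x) isoR.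
Qed.

Lemma red_indec_polyring_interprets_Z (R : comNzRingType) :
  red_indec_polyring R -> interprets_Z R arith_interp.
Proof.
move=> /red_indec_polyring_poly[A [Ared [Aind [f f_bij]]]].
exact: (interprets_Z_iso f_bij (interprets_Z_poly Ared Aind)).
Qed.

Lemma class_nonfield_red_indec R : class_nonfield R -> red_indec_polyring R.
Proof. by move=> [B [X [Bred [Bind [_ h]]]]]; exists B, X. Qed.

Lemma class_char0_red_indec R : class_char0 R -> red_indec_polyring R.
Proof. by move=> [B [X [Bred [Bind [_ h]]]]]; exists B, X. Qed.

Lemma class_fieldpos_red_indec R : class_fieldpos R -> red_indec_polyring R.
Proof.
move=> [F [_ isoR]]; exists F, unit; split; first exact: field_reduced.
split; first exact: field_indecomposable.
by split=> //; exact: ring_iso_trans (ring_iso_sym (ring_iso_poly_unit F)) isoR.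
Qed.

(** Outside characteristic zero, write [R] as univariate over [A], the polynomial ring in the other
    indeterminates. Either [A] is not a field, or it is one whose positive characteristic comes from
    [B]. *)
Lemma red_indec_polyring_classes R : red_indec_polyring R ->
  class_nonfield R \/ class_char0 R \/ class_fieldpos R.
Proof.
move=> [B [X [Bred [Bind [[x] isoR]]]]].
have [B0|Bpos] := classic (char_zero B); first by right; left; exists B, X.
set A : comNzRingType := polyring B {y : X | y != x}.
have isoA : ring_iso {poly A} R := ring_iso_trans (ring_iso_poly_remove B x) isoR.
have [fieldA|nfieldA] := classic (is_field A); last first.
  left; exists A, unit; split; first exact: polyring_reduced.
  split; first exact: polyring_indecomposable.
  do 2 split=> //; exact: ring_iso_trans (ring_iso_sym (ring_iso_poly_unit A)) isoA.
right; right; have [n nB n0] : exists2 n : nat, n%:R = 0 :> B & n <> 0%N.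
  by apply: NNPP => none; apply: Bpos => n nB; apply: NNPP => n0; apply: none; exists n.
have nA : n%:R = 0 :> A.
  have := congr1 (@mkmalgU {cmonom {y : X | y != x}} B mone) nB.
  by rewrite raddf0 => <-; symmetry; exact: mpolyC_nat.
have [F eqF] := is_field_fieldType fieldA; move: (A) eqF nA isoA => C eqF.
rewrite eqF => nF isoF; exists F; split=> //.
by exists n; split=> //; rewrite lt0n; apply/eqP.
Qed.

Theorem theorem3p2 :
  (forall R : comNzRingType, red_indec_polyring R -> arith_interpretable R) /\
  (forall R : comNzRingType, red_indec_polyring R ->
     class_nonfield R \/ class_char0 R \/ class_fieldpos R) /\
  (forall R : comNzRingType,
     class_nonfield R \/ class_char0 R \/ class_fieldpos R -> red_indec_polyring R) /\
  uniformly_interpretable class_nonfield /\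
  uniformly_interpretable class_char0 /\
  uniformly_interpretable class_fieldpos.
Proof.
split; first by move=> R ?; exists arith_interp; exact: red_indec_polyring_interprets_Z.
split; first exact: red_indec_polyring_classes.
split=> [R [/class_nonfield_red_indec|[/class_char0_red_indec|/class_fieldpos_red_indec]] //|].
by split; last split; exists arith_interp => R ?; apply: red_indec_polyring_interprets_Z;
  [exact: class_nonfield_red_indec|exact: class_char0_red_indec|exact: class_fieldpos_red_indec].
Qed.
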